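(* Let $\mathcal{H}$ be a real Hilbert space with norm $\|\cdot\|$, and let $U\subset\mathcal{H}$ be a nonempty closed subset such that $cU\subset U$ for all $0\le c\le 1$. Let $T:U\to U$ be Lipschitz continuous, i.e. there is a constant $L>0$ such that $\|T(u)-T(v)\|\le L\|u-v\|$ for all $u,v\in U$. Then $T$ has an eigenvector in the sense that there exist $u^*\in U$ and $\lambda>0$ such that $T(u^* )=\lambda u^*$.
   Context: Here ''eigenvector'' means only a pair $(u^*,\lambda)$ with $T(u^* )=\lambda u^*$; it is not required that $u^*\neq 0$. The operator $T$ is not assumed to be linear. For $c\in\mathbb{R}$, $cU=\{cu : u\in U\}$. *)

(* Defs.v *)
From HB Require Import structures.
From mathcomp Require Export all_boot all_order all_algebra.
From mathcomp Require Export all_classical all_reals all_analysis.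
Export numFieldNormedType.Exports.

#[export] Set Implicit Arguments.
#[export] Unset Strict Implicit.
#[export] Unset Printing Implicit Defensive.

Local Open Scope ring_scope.

(* A complete normed module over the reals equipped with an inner product dot
   (a symmetric positive definite bilinear form) is a real Hilbert space when
   its norm, and hence its topology, is the one induced by dot. *)
Definition norm_induced_by (R : realType) (H : normedModType R)
    (dot : {dot H for idfun}) : Prop :=
  forall u : H, `|u| = Num.sqrt (dot u u).

(* Main.v *)
From HB Require Import structures.
Require Import Defs.

Import Order.TTheory GRing.Theory Num.Theory.

Local Open Scope classical_set_scope.
Local Open Scope ring_scope.

(** If T is L-Lipschitz on U, then (L + 1)^-1 T has Lipschitz constant
    L / (L + 1) < 1, and it still maps U into itself because
    0 <= (L + 1)^-1 <= 1. Banach's fixed point theorem on the closed subset U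
    of the complete space H gives u with u = (L + 1)^-1 T u, so u is an
    eigenvector of T for the eigenvalue L + 1. *)
Theorem proposition3p1 (R : realType) (H : completeNormedModType R)
    (dot : {dot H for idfun}) (dot_norm : norm_induced_by dot)
    (U : set H) (U_neq0 : U !=set0) (U_closed : closed U)
    (U_scale : forall c : R, 0 <= c -> c <= 1 ->
       [set c *: u | u in U] `<=` U)
    (T : {fun U >-> U})
    (T_lipschitz : exists2 L : R, 0 < L & L.-lipschitz_U T) :
  exists u : H, exists lambda : R,
    [/\ U u, 0 < lambda & T u = lambda *: u].
Proof.
have [L L_gt0 TL] := T_lipschitz.
have L1_gt0 : 0 < L + 1 by rewrite addr_gt0.
have inv_ge0 : 0 <= (L + 1)^-1 by rewrite invr_ge0 ltW.
have inv_le1 : (L + 1)^-1 <= 1 by rewrite invf_le1// lerDr ltW.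
pose S u := (L + 1)^-1 *: T u.
have S_fun : set_fun U U S.
  move=> u Uu; apply: (U_scale _ inv_ge0 inv_le1).
  by exists (T u) => //; exact: funS.
pose S' : {fun U >-> U} := HB.pack S (isFun.Build _ _ _ _ S S_fun).
have q_ge0 : 0 <= L / (L + 1) by rewrite mulr_ge0// ltW.
have S_contr : is_contraction S'.
  exists (NngNum q_ge0); split=> /=; first by rewrite ltr_pdivrMr// mul1r ltrDl.
  move=> [x y] Uxy /=; rewrite /S -scalerBr normrZ ger0_norm//.
  by rewrite mulrAC [leRHS]mulrC ler_wpM2l//; exact: (TL (x, y)).
have [u Uu u_fix] := banach_fixed_point S_contr U_closed U_neq0.
exists u, (L + 1); split=> //.
by rewrite [in RHS]u_fix /= /S scalerA mulfV ?scale1r// gt_eqF.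
Qed.
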